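(* Let $\mathbb K$ be a non-Archimedean valued field with nontrivial valuation and let $X\neq\{0\}$ be a finite-dimensional topological vector space over $\mathbb K$. Then each operator $T\in L(X)$ is not hypercyclic.
   Context: A non-Archimedean valued field is a commutative field $\mathbb K$ with a map $|\cdot|:\mathbb K\to[0,+\infty)$ such that $|\lambda|=0$ iff $\lambda=0$, $|\lambda\mu|=|\lambda||\mu|$, and $|\lambda+\mu|\le\max\{|\lambda|,|\mu|\}$; the valuation is always assumed nontrivial. $\mathbb K$ carries the topology of the metric $|\lambda-\mu|$. For a topological vector space $X$ over $\mathbb K$, $L(X)$ denotes the set of all continuous linear operators from $X$ to $X$. An operator $T\in L(X)$ is hypercyclic if there exists $\mathbf x\in X$ whose orbit $\{T^n(\mathbf x): n\in\mathbb Z_+\}$ is dense in $X$, where $\mathbb Z_+$ is the set of non-negative integers.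
   Formalization: The topological vector space X is assumed to be Hausdorff (the usual convention); without this the claim fails, e.g. for T = 0 on K with the indiscrete topology, where every orbit is dense. *)

(* Defs.v *)
From HB Require Import structures.
From mathcomp Require Import all_boot all_order all_algebra.
From mathcomp Require Import all_classical all_reals topology.
From mathcomp Require Import pseudometric_normed_Zmodule.

Set Implicit Arguments.
Unset Strict Implicit.
Unset Printing Implicit Defensive.

Import Order.TTheory GRing.Theory Num.Theory.

Local Open Scope classical_set_scope.
Local Open Scope ring_scope.

HB.mixin Record Field_isNonArchValued (R : realType) K & GRing.Field K := {
  abs : K -> R ;
  abs_ge0 : forall a, 0 <= abs a ;
  abs_eq0 : forall a, abs a = 0 <-> a = 0 ;
  absM : forall a b, abs (a * b) = abs a * abs b ;
  abs_ultra : forall a b, abs (a + b) <= Num.max (abs a) (abs b)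
}.

#[short(type="nonArchFieldType")]
HB.structure Definition NonArchField (R : realType) :=
  {K of GRing.Field K & Field_isNonArchValued R K}.

Definition nontrivial_valuation (R : realType) (K : nonArchFieldType R) :=
  exists a : K, a != 0 /\ abs a != 1.

(* The topology of K is carried by an alias of K rather than by K itself, so
   that nonArchFieldType does not have to join the library's ring and
   topological hierarchies. *)
Definition valued_space (R : realType) (K : nonArchFieldType R) : Type := K.

Section ValuedSpace.
Context (R : realType) (K : nonArchFieldType R).

Definition valued_dist (a b : valued_space K) : R := abs ((a : K) - (b : K)).

Lemma abs0 : abs (0 : K) = 0.
Proof. exact/abs_eq0. Qed.

Lemma abs1 : abs (1 : K) = 1.
Proof.
have n0 : abs (1 : K) != 0 by apply/eqP => /abs_eq0/eqP; rewrite oner_eq0.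
by apply: (mulIf n0); rewrite -absM !mul1r.
Qed.

Lemma absN (a : K) : abs (- a) = abs a.
Proof.
suff -> : abs (- a) = abs (-1 : K) * abs a.
  have /eqP : abs (-1 : K) ^+ 2 = 1 by rewrite expr2 -absM mulrNN mulr1 abs1.
  rewrite sqrf_eq1 => /orP[/eqP->|/eqP h]; first by rewrite mul1r.
  by have := abs_ge0 (-1 : K); rewrite h ler0N1.
by rewrite -absM mulN1r.
Qed.

Fact valued_distxx a : valued_dist a a = 0.
Proof. by rewrite /valued_dist subrr abs0. Qed.

Fact valued_dist_eq0 a b : valued_dist a b = 0 -> a = b.
Proof. by move=> /abs_eq0/eqP; rewrite subr_eq0 => /eqP. Qed.

Fact valued_dist_sym a b : valued_dist a b = valued_dist b a.
Proof. by rewrite /valued_dist -absN opprB. Qed.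

Fact valued_dist_triangle b a c :
  valued_dist a c <= valued_dist a b + valued_dist b c.
Proof.
have -> : valued_dist a c = abs (((a : K) - b) + ((b : K) - c)).
  by rewrite addrA subrK.
apply: le_trans (abs_ultra _ _) _.
by rewrite ge_max lerDl lerDr !abs_ge0.
Qed.

HB.instance Definition _ := Choice.on (valued_space K).
HB.instance Definition _ := isMetric.Build R (valued_space K)
  valued_distxx valued_dist_eq0 valued_dist_sym valued_dist_triangle.

End ValuedSpace.

(* The library's [topologicalLmodType] requires a numDomainType of scalars,
   with the topology of its order; these are its axioms over K.  Continuity of
   the opposite follows from that of scaling.  Separation is not included. *)
HB.mixin Record TopologicalLmodule_isNonArchTvs (R : realType)
    (K : nonArchFieldType R) X & Topological X & GRing.Lmodule K X := {
  tvs_add_continuous : continuous (fun z : X * X => z.1 + z.2) ;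
  tvs_scale_continuous :
    continuous (fun z : valued_space K * X => (z.1 : K) *: z.2)
}.

#[short(type="nonArchTvsType")]
HB.structure Definition NonArchTvs (R : realType) (K : nonArchFieldType R) :=
  {X of Topological X & GRing.Lmodule K X
      & TopologicalLmodule_isNonArchTvs R K X}.

#[short(type="finDimNonArchTvsType")]
HB.structure Definition FinDimNonArchTvs (R : realType)
    (K : nonArchFieldType R) := {X of NonArchTvs R K X & Vector K X}.

Definition hypercyclic (X : topologicalType) (T : X -> X) :=
  exists x : X, dense [set iter n T x | n in [set: nat]].

(* Main.v *)
Require Import Defs.
From HB Require Import structures.
From mathcomp Require Import all_boot all_order all_algebra.
From mathcomp Require Import all_classical all_reals topology.
From mathcomp Require Import normedtype sequences.

(** When K is complete, a Hausdorff finite-dimensional X is K^d, and an operator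
    multiplies the volume of every d-tuple by abs (\det T): along an orbit the
    volume of (T^n1 y, ..., T^nd y) is a geometric sequence, whereas density of
    the orbit would let it come close to values both far above and far below
    its starting value. This contradiction is the whole idea.

    Since K may be incomplete, X need not be K^d topologically. For
    instance, K + K s inside the completion of K, with s outside K, is Hausdorff
    of dimension 2 but its line K is dense, and no nonzero continuous linear
    form takes values in K. The completion of X would be a power of the
    completion of K; the argument below keeps from it only the volume function.
    Take a tuple e of smallest length m whose K-span is dense in X
    ([minimal_dense_ex]). By minimality the hyperplanes of the span are not
    dense, which forces the coordinates along e to be continuous on the span
    ([minimal_dense_coord]). They need not extend to X with values in K, but the
    real-valued abs (\det A), as a function of the m-tuples of vectors in the
    span with coordinate matrix A, is Cauchy near every point of X^m, so it
    extends to a continuous D on X^m ([abs_det_extension]).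

    Multiplicativity of the determinant passes to D by density: combining the
    vectors of a tuple by a matrix A multiplies D by abs (\det A), and applying
    T to them multiplies D by the constant value of D at T e. If the orbit of x
    is dense, one can pick n_i with T^(n_i) x so close to e_i that D is
    nonzero at this tuple. Then Q y = `|D (T^(n_1) y, ..., T^(n_m) y)| is a
    continuous function, homogeneous of degree m > 0, nonzero at x, and
    multiplied by a constant under T; [semi_invariant_orbit_not_dense] excludes
    this. *)

Set Implicit Arguments.
Unset Strict Implicit.
Unset Printing Implicit Defensive.

Import Order.TTheory GRing.Theory Num.Theory.
Import numFieldNormedType.Exports.

Local Open Scope classical_set_scope.
Local Open Scope ring_scope.

(** * Non-Archimedean absolute values and determinants *)

Section AbsoluteValue.
Context (R : realType) (K : nonArchFieldType R).
Implicit Types (a b : K) (d : R).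

Lemma absX a n : abs (a ^+ n) = abs a ^+ n.
Proof. by elim: n => [|n IHn]; rewrite ?expr0 ?abs1// !exprS absM IHn. Qed.

Lemma abs_gt0 a : a != 0 -> 0 < abs a.
Proof.
by move=> a0; rewrite lt_def abs_ge0 andbT; apply: contra a0 => /eqP/abs_eq0->.
Qed.

Lemma absV a : abs a^-1 = (abs a)^-1.
Proof.
have [->|a0] := eqVneq a 0; first by rewrite invr0 abs0 invr0.
have aN0 := lt0r_neq0 (abs_gt0 a0).
by apply: (mulfI aN0); rewrite -absM !mulfV// abs1.
Qed.

Lemma abs_sum_le (I : Type) (s : seq I) (P : pred I) (F : I -> K) d :
  0 <= d -> (forall i, P i -> abs (F i) <= d) ->
  abs (\sum_(i <- s | P i) F i) <= d.
Proof.
move=> d0 Fd; elim/big_rec: _ => [|i x Pi xd]; first by rewrite abs0.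
by rewrite (le_trans (abs_ultra _ _))// ge_max Fd.
Qed.

Lemma ler_dist_abs a b : `|abs a - abs b| <= abs (a - b).
Proof.
have le (u v : K) : abs u - abs v <= abs (u - v).
  rewrite lerBlDr -{1}[u](subrK v) (le_trans (abs_ultra _ _))//.
  by rewrite ge_max lerDl lerDr !abs_ge0.
by rewrite ler_norml le andbT lerNl opprB -(absN (a - b)) opprB le.
Qed.

(** Telescoping: swapping one factor at a time costs at most
    d * M ^+ (size s - 1), and the ultrametric inequality takes the maximum of
    these costs instead of their sum; M >= 1 absorbs the missing factor. *)
Lemma abs_prod_sub_le (I : Type) (s : seq I) (F G : I -> K) (M d : R) :
  1 <= M -> 0 <= d -> (forall i, abs (F i) <= M) -> (forall i, abs (G i) <= M) ->
  (forall i, abs (F i - G i) <= d) ->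
  abs (\prod_(i <- s) F i - \prod_(i <- s) G i) <= d * M ^+ size s.
Proof.
move=> M1 d0 FM GM FGd.
have M0 : 0 <= M by exact: le_trans M1.
have prodM (H : I -> K) r : (forall i, abs (H i) <= M) ->
    abs (\prod_(i <- r) H i) <= M ^+ size r.
  move=> HM; elim: r => [|i r IH]; first by rewrite big_nil abs1 expr0.
  by rewrite big_cons absM exprS ler_pM// abs_ge0.
elim: s => [|i s IHs]; first by rewrite !big_nil subrr abs0 mulr_ge0 ?exprn_ge0.
rewrite !big_cons -[_ - _](_ : (F i - G i) * \prod_(j <- s) F j +
    G i * (\prod_(j <- s) F j - \prod_(j <- s) G j) = _); last first.
  by rewrite mulrBl mulrBr addrA subrK.
rewrite (le_trans (abs_ultra _ _))// ge_max !absM /=; apply/andP; split.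
  rewrite ler_pM ?abs_ge0// (le_trans (prodM _ _ _))// exprS.
  by rewrite ler_peMl// exprn_ge0.
by rewrite exprS mulrCA ler_pM ?abs_ge0.
Qed.

(** A Lipschitz bound for the determinant on bounded matrices. The number of
    terms of the Leibniz formula does not enter, by the ultrametric
    inequality. *)
Lemma abs_det_sub_le m (A B : 'M[K]_m) (M d : R) :
  1 <= M -> 0 <= d -> (forall i j, abs (A i j) <= M) ->
  (forall i j, abs (B i j) <= M) -> (forall i j, abs (A i j - B i j) <= d) ->
  `|abs (\det A) - abs (\det B)| <= d * M ^+ m.
Proof.
move=> M1 d0 AM BM ABd; apply: le_trans (ler_dist_abs _ _) _.
rewrite /determinant -sumrB; apply: abs_sum_le => [|s _].
  by rewrite mulr_ge0// exprn_ge0// (le_trans _ M1).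
rewrite -mulrBr absM absX absN abs1 expr1n mul1r.
have szm : size (index_enum 'I_m) = m by rewrite -[RHS]card_ord cardT enumT.
by rewrite -[in d * _]szm; apply: abs_prod_sub_le.
Qed.

Hypothesis ntK : nontrivial_valuation K.

Lemma abs_lt1_ex : exists2 a : K, a != 0 & abs a < 1.
Proof.
have [a [a0 /lt_total/orP[a1|a1]]] := ntK; first by exists a.
exists a^-1; first by rewrite invr_eq0.
by rewrite absV invf_lt1// abs_gt0.
Qed.

Lemma abs_le_ex d : 0 < d -> exists2 a : K, a != 0 & abs a <= d.
Proof.
move=> d0; have [a a0 a1] := abs_lt1_ex.
have : `|abs a| < 1 by rewrite ger0_norm ?abs_ge0.
move=> /cvg_expr/cvgr0Pnorm_le/(_ d d0)[N _ /(_ N (leqnn _))/=].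
rewrite ger0_norm ?exprn_ge0 ?abs_ge0// -absX => aN.
by exists (a ^+ N); rewrite ?expf_neq0.
Qed.

Lemma abs_gt1_ex : exists a : K, 1 < abs a.
Proof.
have [a a0 a1] := abs_lt1_ex; exists a^-1.
by rewrite absV invf_gt1// abs_gt0.
Qed.

End AbsoluteValue.

(** * Density and extension of real-valued functions *)

Lemma dense_closed_setT (Z : topologicalType) (S C : set Z) :
  dense S -> closed C -> S `<=` C -> forall z, C z.
Proof.
move=> dS cC SC z; apply: contrapT => Cz.
have [] := dS (~` C); [by exists z|exact: closed_openC|].
by move=> w [/= Cw /SC].
Qed.

Lemma dense_eq (R : realType) (Z : topologicalType) (S : set Z) (f g : Z -> R) :
  dense S -> continuous f -> continuous g ->
  (forall z, S z -> f z = g z) -> f =1 g.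
Proof.
move=> dS cf cg fg z; apply/eqP; rewrite -subr_eq0; apply/eqP.
apply: (dense_closed_setT (C := [set w | f w - g w = 0]) dS) => [|w Sw].
  apply: (@preimage_closed _ R (fun w => f w - g w) [set x | x = 0]).
    by move=> w _; apply: cvgB; [exact: cf|exact: cg].
  exact: closed_eq.
by rewrite /= fg// subrr.
Qed.

(** Extension by continuity from a dense set, for a function f of a parameter a
    of the points E a. The Cauchy condition makes f compatible with E, and it is
    stated with neighbourhoods so that Z needs no uniform structure. *)
Lemma dense_extension (R : realType) (P : Type) (Z : topologicalType)
    (E : P -> Z) (f : P -> R) :
  dense (range E) ->
  (forall (z : Z) (e : R), 0 < e -> exists2 N : set Z, nbhs z N &
     forall a b, N (E a) -> N (E b) -> `|f a - f b| <= e) ->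
  exists2 D : Z -> R, continuous D & forall a, D (E a) = f a.
Proof.
move=> dE fosc.
pose G (z : Z) := filter_from (nbhs z) (fun N : set Z => E @^-1` N).
have FG z : ProperFilter (G z).
  apply: filter_from_proper.
    apply: filter_from_filter; first by exists setT; exact: filterT.
    by move=> M N zM zN; exists (M `&` N) => //; exact: filterI.
  move=> N; rewrite nbhsE => -[O [oO Oz] ON].
  by have [w [Ow [a _ aw]]] := dE O (ex_intro _ z Oz) oO;
    exists a; apply: ON; rewrite aw.
have Gcvg z : cvg (f @ G z).
  apply/cauchy_cvgP/cauchy_ballP => e e0.
  have [N zN Nf] := fosc z (e / 2) (divr_gt0 e0 (ltr0Sn _ 1)).
  rewrite near_map2 /=; exists (E @^-1` N, E @^-1` N).
    by split; exists N.
  move=> [a b] [/= aN bN]; rewrite /ball/=.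
  by rewrite (le_lt_trans (Nf _ _ aN bN))// gtr_pMr// invf_lt1// ltr1n.
pose D z := lim (f @ G z).
(* The same N serves every w in its interior, which gives continuity of D. *)
have DE (z : Z) (e : R) : 0 < e -> exists2 N : set Z, nbhs z N &
    forall (w : Z) a, nbhs w N -> N (E a) -> `|D w - f a| <= e.
  move=> e0; have [N zN Nf] := fosc z e e0.
  exists N => // w a wN aN; rewrite distrC.
  have : (f a - f b) @[b --> G w] --> f a - D w.
    by apply: cvgB; [exact: cvg_cst|exact: Gcvg].
  move=> /cvg_norm; apply: (@closed_cvg _ R (G w) _ _ (fun x : R => x <= e)
    (@closed_le R e) _ _).
  by exists N => // b bN; exact: Nf.
exists D.
  move=> z; apply/cvgrPdist_le => e e0.
  have [N zN Nf] := DE z (e / 2) (divr_gt0 e0 (ltr0Sn _ 1)).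
  have [a Na] : exists a, N (E a).
    by have /filter_ex : G z (E @^-1` N) by exists N.
  near=> w.
  rewrite (le_trans (ler_distD (f a) _ _))// (splitr e) lerD ?Nf//.
  rewrite distrC Nf//; near: w.
  exact: nbhs_interior.
move=> a; apply/eqP; rewrite -subr_eq0 -normr_eq0 eq_le normr_ge0 andbT.
apply/ler_addgt0Pl => e e0; rewrite addr0.
have [N zN Nf] := DE (E a) e e0.
by apply: Nf => //; exact: nbhs_singleton.
Unshelve. all: end_near. Qed.

(** * Topological vector spaces over K *)

Section Tvs.
Context (R : realType) (K : nonArchFieldType R) (X : finDimNonArchTvsType K).

Lemma scale_continuous (a : K) : continuous (fun v : X => a *: v).
Proof.
move=> v; apply: (@continuous2_cvg _ (valued_space K) X X (nbhs v) _
  (fun=> a) id (fun (b : K) w => b *: w) a v).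
- exact: (tvs_scale_continuous (a, v)).
- exact: cvg_cst.
- exact: cvg_id.
Qed.

Lemma cvgD_tvs (Z : Type) (F : set_system Z) (FF : Filter F) (f g : Z -> X)
    (u v : X) : f @ F --> u -> g @ F --> v -> (fun z => f z + g z) @ F --> u + v.
Proof.
by apply: continuous2_cvg; exact: (tvs_add_continuous (u, v)).
Qed.

Lemma cvgB_tvs (Z : Type) (F : set_system Z) (FF : Filter F) (f g : Z -> X)
    (u v : X) : f @ F --> u -> g @ F --> v -> (fun z => f z - g z) @ F --> u - v.
Proof.
move=> fu gv; apply: cvgD_tvs => //; rewrite -scaleN1r.
under eq_fun do rewrite -scaleN1r.
exact: (@continuous_cvg _ X X _ _ g (fun w : X => -1 *: w) v
  (@scale_continuous (-1) v)).
Qed.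

Lemma cvg_sum_tvs (Z : Type) (F : set_system Z) (FF : Filter F) (I : Type)
    (s : seq I) (f : I -> Z -> X) (u : I -> X) :
  (forall i, f i @ F --> u i) ->
  (fun z => \sum_(i <- s) f i z) @ F --> \sum_(i <- s) u i.
Proof.
move=> fu; elim: s => [|i s IHs].
  by rewrite big_nil; under eq_fun do rewrite big_nil; exact: cvg_cst.
rewrite big_cons; under eq_fun do rewrite big_cons.
exact: cvgD_tvs.
Qed.

Lemma cvg_col (Z : Type) (F : set_system Z) (FF : Filter F) (m : nat)
    (f : Z -> 'cV[X]_m) (v : 'cV[X]_m) :
  (forall i, (fun z => f z i 0) @ F --> v i 0) -> f @ F --> v.
Proof.
move=> fv N [P vP PN]; near=> z; apply: PN.
near: z.
have : \forall z \near F, forall i : 'I_m, P i 0 (f z i 0).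
  by apply: filter_forall => i; exact: fv (vP i 0).
by apply: filterS => z Pz i j; rewrite ord1.
Unshelve. all: end_near. Qed.

Lemma col_entry_continuous (m : nat) (i : 'I_m) :
  continuous (fun v : 'cV[X]_m => v i 0).
Proof.
move=> v N vN; exists (fun k j => if k == i then N else setT).
  by move=> k j; rewrite ord1; case: eqP => [->//|_]; exact: filterT.
by move=> w /(_ i 0) /=; rewrite eqxx.
Qed.

Definition comb (m : nat) (c : 'rV[K]_m) (v : 'cV[X]_m) : X :=
  \sum_j c 0 j *: v j 0.

Lemma combB m (b c : 'rV[K]_m) v : comb (b - c) v = comb b v - comb c v.
Proof. by rewrite -sumrB; apply: eq_bigr => j _; rewrite !mxE scalerBl. Qed.

Lemma combZ m (a : K) (c : 'rV[K]_m) v : comb (a *: c) v = a *: comb c v.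
Proof. by rewrite scaler_sumr; apply: eq_bigr => j _; rewrite mxE scalerA. Qed.

(** The action of square matrices over K on tuples of vectors, that is, the
    product A * v with the scalars on the left. *)
Definition lincomb (m : nat) (A : 'M[K]_m) (v : 'cV[X]_m) : 'cV[X]_m :=
  \col_i comb (row i A) v.

Lemma lincombE m (A : 'M[K]_m) (v : 'cV[X]_m) i :
  lincomb A v i 0 = \sum_j A i j *: v j 0.
Proof. by rewrite mxE; apply: eq_bigr => j _; rewrite mxE. Qed.

Lemma lincomb_mul m (A B : 'M[K]_m) v :
  lincomb (A *m B) v = lincomb A (lincomb B v).
Proof.
apply/colP => i; rewrite !lincombE.
under eq_bigr do rewrite mxE scaler_suml.
rewrite exchange_big; apply: eq_bigr => j _ /=.
rewrite lincombE scaler_sumr; apply: eq_bigr => k _.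
by rewrite scalerA.
Qed.

Lemma lincomb_scalar m (a : K) (v : 'cV[X]_m) i :
  lincomb a%:M v i 0 = a *: v i 0.
Proof.
rewrite lincombE (bigD1 i)//= mxE eqxx mulr1n big1 ?addr0// => j ji.
by rewrite mxE eq_sym (negPf ji) mulr0n scale0r.
Qed.

Lemma lincomb1 m (v : 'cV[X]_m) : lincomb 1%:M v = v.
Proof. by apply/colP => i; rewrite lincomb_scalar scale1r. Qed.

Lemma lincomb_map m (T : {linear X -> X}) (A : 'M[K]_m) v :
  map_mx T (lincomb A v) = lincomb A (map_mx T v).
Proof.
apply/colP => i; rewrite mxE !lincombE linear_sum; apply: eq_bigr => j _.
by rewrite linearZ mxE.
Qed.

Lemma lincomb_continuous m (A : 'M[K]_m) : continuous (lincomb A).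
Proof.
move=> v; apply: (@cvg_col _ _ (nbhs_filter v)) => i; rewrite lincombE.
under eq_fun do rewrite lincombE.
apply: (@cvg_sum_tvs _ (nbhs v) (nbhs_filter v)) => j.
apply: (@continuous_cvg _ X X (nbhs v) (nbhs_filter v) _
  (fun w : X => A i j *: w) _ (@scale_continuous (A i j) _)).
exact: col_entry_continuous.
Qed.

Lemma map_mx_continuous m (T : X -> X) : continuous T ->
  continuous (fun v : 'cV[X]_m => map_mx T v).
Proof.
move=> cT v; apply: (@cvg_col _ _ (nbhs_filter v)) => i; rewrite mxE.
under eq_fun do rewrite mxE.
apply: (@continuous_cvg _ X X (nbhs v) (nbhs_filter v) _ T _ (cT _)).
exact: col_entry_continuous.
Qed.

Lemma lincomb_dense m (e : 'cV[X]_m) :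
  dense (range (fun c : 'rV[K]_m => comb c e)) ->
  dense (range (fun A => lincomb A e)).
Proof.
move=> de O [v Ov] oO.
have [P vP PO] : nbhs v O by exact: open_nbhs_nbhs.
have /choice[c cP] : forall i, exists c : 'rV[K]_m, P i 0 (comb c e).
  move=> i; have : nbhs (v i 0) (P i 0) := vP i 0.
  rewrite nbhsE => -[U [oU Uv] UP].
  have [_ [/[swap] -[c _ <-] Uc]] := de U (ex_intro _ _ Uv) oU.
  by exists c; exact: UP.
exists (lincomb (\matrix_i c i) e); split; last by eexists.
apply: PO => i j; rewrite ord1 mxE rowK; exact: cP.
Qed.

Lemma scale_small (W : set X) : nbhs (0 : X) W ->
  exists2 d : R, 0 < d & exists2 V : set X, nbhs (0 : X) V &
    forall a v, abs a < d -> V v -> W (a *: v).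
Proof.
move=> W0; have := tvs_scale_continuous ((0 : K) : valued_space K, 0 : X).
rewrite /continuous_at/= scaler0 => /(_ _ W0) -[[P Q] /= [P0 Q0] PQ].
have [d /= d0 dP] : nbhs_ball (0 : valued_space K) P by rewrite nbhs_ballE.
exists d => //; exists Q => // a v ad Qv; apply: (PQ (a, v)); split => //=.
by apply: dP; rewrite ballEmdist/=; change (abs (0 - a) < d); rewrite sub0r absN.
Qed.

Lemma sub_small (W : set X) : nbhs (0 : X) W -> forall x : X,
  exists2 V : set X, nbhs x V & forall v w, V v -> V w -> W (v - w).
Proof.
move=> W0 x.
have : (fun z : X * X => z.1 - z.2) @ nbhs (x, x) --> x - x.
  by apply: cvgB_tvs; [exact: cvg_fst|exact: cvg_snd].
rewrite subrr => /(_ _ W0) -[[P Q] /= [P0 Q0] PQ].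
exists (P `&` Q); first exact: filterI.
by move=> v w [Pv _] [_ Qw]; exact: (PQ (v, w)).
Qed.

(** * Minimal tuples with dense span *)

(** The substitute for a basis: no entry of e can be dropped without losing
    density of the span. Non-density of the coordinate hyperplanes is what the
    continuity of the coordinates is deduced from. *)
Definition minimal_dense m (e : 'cV[X]_m) :=
  dense (range (fun c : 'rV[K]_m => comb c e)) /\
  forall i, ~ dense [set comb c e | c in [set c : 'rV[K]_m | c 0 i = 0]].

Lemma minimal_dense_ex : exists m (e : 'cV[X]_m), minimal_dense e.
Proof.
pose P m := `[< exists e : 'cV[X]_m,
  dense (range (fun c : 'rV[K]_m => comb c e)) >].
have exP : exists m, P m.
  exists (\dim {:X}%VS); apply/asboolP; exists (\col_j (vbasis {:X}%VS)`_j).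
  move=> O [x Ox] _; exists x; split => //.
  exists (\row_j coord (vbasis {:X}%VS) j x) => //.
  rewrite [RHS](coord_vbasis (memvf x)); apply: eq_bigr => j _.
  by rewrite !mxE.
case: (ex_minnP exP) => m /asboolP[e de] mP; exists m, e; split=> // i di.
case: m => [|m] in e de mP i di *; first by case: i di.
suff /mP : P m by rewrite ltnn.
apply/asboolP; exists (row' i e) => O O0 oO.
have [_ [/[swap] -[c /= ci <-] Ox]] := di O O0 oO.
exists (comb c e); split=> //; exists (col' i c) => //.
rewrite [RHS](bigD1_ord i)//= ci scale0r add0r.
by apply: eq_bigr => j _; rewrite !mxE.
Qed.

(** Otherwise 0 alone would be dense, which separation forbids in a nonzero
    space. *)
Lemma minimal_dense_gt0 m (e : 'cV[X]_m) :
  hausdorff_space X -> (exists x : X, x != 0) -> minimal_dense e -> (0 < m)%N.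
Proof.
move=> hX [x x0] [de _]; case: m => // in e de *.
move: hX; rewrite open_hausdorff.
move=> /(_ _ _ x0)[[A B] /= [xA zB] [oA oB /eqP AB]].
have [] := de A; [by exists x; move: xA; rewrite inE|by []|].
move=> _ [/[swap] -[c _ <-]]; rewrite /comb big_ord0 => A0.
have : (A `&` B) 0 by split=> //; move: zB; rewrite inE.
by rewrite AB.
Qed.

(** The i-th coordinate is bounded near 0. Some y = comb b e has a neighbourhood
    that misses the hyperplane c 0 i = 0. A small vector comb c e with a large
    i-th coordinate would give (b i / c i) *: comb c e, still small, and
    subtracting it from y would land in the hyperplane. *)
Lemma minimal_dense_coord m (e : 'cV[X]_m) (i : 'I_m) :
  minimal_dense e -> exists2 d : R, 0 < d & exists2 V : set X, nbhs (0 : X) V &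
    forall c : 'rV[K]_m, V (comb c e) -> abs (c 0 i) <= d.
Proof.
move=> [de /(_ i)/denseNE[O [[x [oO Ox]] OH]]].
have [_ [/[swap] -[b _ <-] Oy]] := de O (ex_intro _ x Ox) oO.
have bi0 : b 0 i != 0.
  apply/eqP => bi0.
  have : (O `&` [set comb c e | c in [set c : 'rV[K]_m | c 0 i = 0]]) (comb b e).
    by split=> //; exists b.
  by rewrite OH.
have [W W0 WO] : exists2 W : set X, nbhs (0 : X) W &
    forall w, W w -> O (comb b e - w).
  exists [set w | O (comb b e - w)] => //.
  have : (fun w => comb b e - w) @ nbhs (0 : X) --> comb b e - 0.
    by apply: cvgB_tvs; [exact: cvg_cst|exact: cvg_id].
  by rewrite subr0; apply; exact: open_nbhs_nbhs.
have [d d0 [V V0 VW]] := scale_small W0.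
exists (abs (b 0 i) / d); first by rewrite divr_gt0// abs_gt0.
exists V => // c Vc; rewrite leNgt; apply/negP.
rewrite ltr_pdivrMr// => bc.
have ci0 : c 0 i != 0.
  by apply: contraTneq bc => ->; rewrite abs0 mul0r -leNgt abs_ge0.
have abc : abs (b 0 i / c 0 i) < d.
  by rewrite absM absV ltr_pdivrMr ?abs_gt0// mulrC.
have := WO _ (VW _ _ abc Vc); rewrite -combZ -combB => Oh.
have : (O `&` [set comb c e | c in [set c : 'rV[K]_m | c 0 i = 0]])
    (comb (b - (b 0 i / c 0 i) *: c) e).
  by split=> //; eexists; last reflexivity; rewrite /= !mxE divfK// subrr.
by rewrite OH.
Qed.

Hypothesis ntK : nontrivial_valuation K.

(** The bound of [minimal_dense_coord] is made arbitrarily small by rescaling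
    the neighbourhood; a trivial valuation provides no small scalars. *)
Lemma minimal_dense_coord_small m (e : 'cV[X]_m) (d : R) :
  minimal_dense e -> 0 < d -> exists2 V : set X, nbhs (0 : X) V &
    forall c : 'rV[K]_m, V (comb c e) -> forall i, abs (c 0 i) <= d.
Proof.
move=> me d0.
have /choice[V VP] (i : 'I_m) : exists V : set X, nbhs (0 : X) V /\
    forall c : 'rV[K]_m, V (comb c e) -> abs (c 0 i) <= d.
  have [r r0 [V V0 Vr]] := minimal_dense_coord i me.
  have [a a0 ad] := abs_le_ex ntK (divr_gt0 d0 r0).
  exists [set v | V (a^-1 *: v)]; split.
    by apply: (@scale_continuous a^-1 0); rewrite scaler0.
  move=> c /=; rewrite -combZ => /Vr; rewrite mxE absM absV.
  rewrite ler_pdivrMl ?abs_gt0// => /le_trans; apply.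
  by rewrite -ler_pdivlMr.
exists [set v | forall i, V i v]; last by move=> c Vc i; exact: (VP i).2.
by apply: filter_forall => i; exact: (VP i).1.
Qed.

(** Coordinate matrices are Cauchy near every tuple v of X, including those
    outside the span, where their limit has entries in the completion
    of K. *)
Lemma minimal_dense_coord_cauchy m (e : 'cV[X]_m) (v : 'cV[X]_m) (d : R) :
  minimal_dense e -> 0 < d -> exists2 N : set 'cV[X]_m, nbhs v N &
    forall A B : 'M[K]_m, N (lincomb A e) -> N (lincomb B e) ->
    forall i j, abs (A i j - B i j) <= d.
Proof.
move=> me d0; have [U U0 Ud] := minimal_dense_coord_small me d0.
have /choice[V VP] (i : 'I_m) : exists V : set X, nbhs (v i 0) V /\
    forall x y, V x -> V y -> U (x - y).
  by have [V vV VU] := sub_small U0 (v i 0); exists V.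
exists [set w | forall i j, V i (w i j)].
  by exists (fun i _ => V i) => // i j; rewrite ord1; exact: (VP i).1.
move=> A B NA NB i j.
have := Ud (row i A - row i B); rewrite combB => /(_ _ j); rewrite !mxE; apply.
by apply: (VP i).2; [have := NA i 0|have := NB i 0]; rewrite mxE.
Qed.

Lemma minimal_dense_det_cauchy m (e : 'cV[X]_m) (v : 'cV[X]_m) (d : R) :
  minimal_dense e -> 0 < d -> exists2 N : set 'cV[X]_m, nbhs v N &
    forall A B : 'M[K]_m, N (lincomb A e) -> N (lincomb B e) ->
    `|abs (\det A) - abs (\det B)| <= d.
Proof.
move=> me d0.
(* Coordinates within 1 of those of a fixed C give a uniform bound M. *)
have [N1 vN1 N1P] := minimal_dense_coord_cauchy v me ltr01.
have [C NC] : exists C, N1 (lincomb C e).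
  move: vN1; rewrite nbhsE => -[O [oO Ov] ON].
  have [_ [/[swap] -[C _ <-] Ow]] := lincomb_dense me.1 (ex_intro _ v Ov) oO.
  by exists C; exact: ON.
pose M := \big[Num.max/1]_i \big[Num.max/1]_j abs (C i j).
have M1 : 1 <= M.
  by rewrite /M; elim/big_rec: _ => // i x _ x1; rewrite le_max x1 orbT.
have CM i j : abs (C i j) <= M.
  apply: le_trans (le_bigmax _ _ i); exact: (le_bigmax _ (fun j => abs (C i j))).
have M0 : 0 < M ^+ m by rewrite exprn_gt0// (lt_le_trans ltr01).
have [N2 vN2 N2P] := minimal_dense_coord_cauchy v me (divr_gt0 d0 M0).
exists (N1 `&` N2); first exact: filterI.
have bounded A : N1 (lincomb A e) -> forall i j, abs (A i j) <= M.
  move=> NA i j; rewrite -[A i j](subrK (C i j)).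
  rewrite (le_trans (abs_ultra _ _))// ge_max CM.
  by rewrite (le_trans (N1P _ _ _ _ _ _) M1).
move=> A B [N1A N2A] [N1B N2B].
rewrite -[leRHS](divfK (lt0r_neq0 M0)).
apply: abs_det_sub_le => //; [exact/ltW/divr_gt0|exact: bounded|exact: bounded|].
exact: N2P.
Qed.

(** The absolute value of the determinant in the basis e of the completion of X,
    restricted to X. *)
Lemma abs_det_extension m (e : 'cV[X]_m) : minimal_dense e ->
  exists2 D : 'cV[X]_m -> R, continuous D &
    forall A, D (lincomb A e) = abs (\det A).
Proof.
move=> me; apply: dense_extension; first exact: lincomb_dense me.1.
by move=> v d; exact: minimal_dense_det_cauchy.
Qed.

(** * Hypercyclicity *)

(** Along the orbit, Q is geometric with ratio q: it never exceeds Q x if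
    q <= 1, and never goes below Q x otherwise. By density the same holds on X,
    against the large multiples of x in the first case and 0 in the second. *)
Lemma semi_invariant_orbit_not_dense (T : X -> X) (Q : X -> R) (m : nat) (q : R)
    (x : X) :
  continuous Q -> (0 < m)%N -> (forall a y, Q (a *: y) = abs a ^+ m * Q y) ->
  0 <= q -> (forall y, Q (T y) = q * Q y) -> 0 < Q x ->
  ~ dense [set iter n T x | n in [set: nat]].
Proof.
move=> cQ m0 QZ q0 QT Qx dx.
have Qorb k : Q (iter k T x) = q ^+ k * Q x.
  by elim: k => [|k IHk]; rewrite ?expr0 ?mul1r//= QT IHk exprS mulrA.
have [q1|q1] := leP q 1.
  have [a a1] := abs_gt1_ex ntK.
  suff : Q (a *: x) <= Q x.
    by rewrite QZ ger_pMl// leNgt exprn_egt1// -lt0n m0.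
  apply: (@dense_closed_setT _ _ [set y | Q y <= Q x] dx _ _ (a *: x)).
    apply: (@preimage_closed _ R Q [set t | t <= Q x]); last exact: closed_le.
    by move=> y _; exact: cQ.
  by move=> _ [k _ <-]; rewrite /= Qorb ger_pMl// exprn_ile1.
suff : Q x <= Q 0.
  by rewrite -(scale0r x) QZ abs0 expr0n gtn_eqF// mul0r leNgt Qx.
apply: (@dense_closed_setT _ _ [set y | Q x <= Q y] dx _ _ 0).
  apply: (@preimage_closed _ R Q [set t | Q x <= t]); last exact: closed_ge.
  by move=> y _; exact: cQ.
by move=> _ [k _ <-]; rewrite /= Qorb ler_pMl// exprn_ege1// ltW.
Qed.

End Tvs.

Theorem proposition3p1 (R : realType) (K : nonArchFieldType R)
    (X : finDimNonArchTvsType K) :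
  nontrivial_valuation K ->
  hausdorff_space X ->
  (exists x : X, x != 0) ->
  forall T : {linear X -> X}, continuous T -> ~ hypercyclic T.
Proof.
move=> ntK hX X0 T cT [x dx].
have [m [e me]] := minimal_dense_ex X.
have m0 := minimal_dense_gt0 hX X0 me.
have [D cD DE] := abs_det_extension ntK me.
have dE := lincomb_dense me.1.
have De : D e = 1 by rewrite -[e]lincomb1 DE det1 abs1.
have DA A v : D (lincomb A v) = abs (\det A) * D v.
  apply: (dense_eq (f := fun w => D (lincomb A w))
    (g := fun w => abs (\det A) * D w) dE) v.
  - by move=> v; apply: (@continuous_comp _ _ R (lincomb A) D);
      [exact: lincomb_continuous|exact: cD].
  - by move=> v; have FF := nbhs_filter v; exact: (cvgM (cvg_cst _) (cD v)).
  - by move=> _ [B _ <-]; rewrite -lincomb_mul !DE det_mulmx absM.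
pose c := D (map_mx T e).
have DT v : D (map_mx T v) = c * D v.
  apply: (dense_eq (f := fun w => D (map_mx T w))
    (g := fun w => c * D w) dE) v.
  - by move=> v; apply: (@continuous_comp _ _ R (map_mx T) D);
      [exact: map_mx_continuous|exact: cD].
  - by move=> v; have FF := nbhs_filter v; exact: (cvgM (cvg_cst _) (cD v)).
  - by move=> _ [B _ <-]; rewrite lincomb_map DA DE mulrC.
(* Orbit points close enough to the entries of e, where D is 1. *)
have [n Dn] : exists n : 'I_m -> nat, D (\col_i iter (n i) T x) != 0.
  have [P eP PD] : nbhs e [set v | D v != 0].
    have D0 : nbhs (D e) [set t | t != 0].
      by apply: open_nbhs_nbhs; split; [exact: open_neq|rewrite /= De oner_neq0].
    exact: (cD e _ D0).
  have /choice[n nP] i : exists n, P i 0 (iter n T x).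
    have : nbhs (e i 0) (P i 0) := eP i 0; rewrite nbhsE => -[U [oU Ue] UP].
    have [_ [/[swap] -[n _ <-] Uw]] := dx U (ex_intro _ _ Ue) oU.
    by exists n; exact: UP.
  by exists n; apply: PD => i j; rewrite ord1 mxE.
pose Q y := `|D (\col_i iter (n i) T y)|.
apply: (semi_invariant_orbit_not_dense (Q := Q) (q := `|c|) ntK _ m0 _ _ _ _ dx).
- move=> y; apply: cvg_norm.
  apply: (@continuous_cvg _ _ R (nbhs y) _ (fun y => \col_i iter (n i) T y) D
    _ (cD _)).
  apply: cvg_col => i; rewrite mxE; under eq_fun do rewrite mxE.
  elim: (n i) => [|k IHk] /=; first exact: cvg_id.
  exact: (@continuous_cvg _ X X (nbhs y) _ _ T _ (cT _)).
- move=> a y.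
  have -> : Q (a *: y) = `|D (lincomb a%:M (\col_i iter (n i) T y))|.
    congr (`|D _|); apply/colP => i; rewrite lincomb_scalar !mxE.
    by elim: (n i) => //= k ->; rewrite linearZ.
  by rewrite DA det_scalar absX normrM ger0_norm// exprn_ge0// abs_ge0.
- exact: normr_ge0.
- move=> y; rewrite /Q -normrM -DT; congr (`|D _|); apply/colP => i.
  by rewrite !mxE -iterS iterSr.
- by rewrite normr_gt0.
Qed.
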